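(* Let $\mu\in L^2(0,1)$ and $k\ge1$. Then $$K_{\mu,k}(\omega)=\frac{\pi\sqrt2\,\langle\mu^2,\varphi_k'\rangle}{k\,\omega^2}+o\left(\frac1{\omega^2}\right)\quad\text{when }\omega\to+\infty.$$ If $\mu\in H^\nu_{(0)}(0,1)$ for some $\nu\in(0,2]$, then $$K_{\mu,k}(\omega)=\frac{\pi\sqrt2\,\langle\mu^2,\varphi_k'\rangle}{k\,\omega^2}+\mathcal O\left(\frac1{\omega^{2+\nu}}\right)\quad\text{when }\omega\to+\infty.$$
   Context: All functions are real-valued. For $j\ge1$, $\lambda_j=(j\pi)^2$, $\varphi_j(x)=\sqrt2\sin(j\pi x)$; $\langle f,g\rangle=\int_0^1fg$. $H^\nu_{(0)}(0,1)$ is the space of $\mu$ with $\|\mu\|_{H^\nu_{(0)}}^2=\sum_{j\ge1}\lambda_j^\nu\langle\mu,\varphi_j\rangle^2<\infty$. With $\lambda_{n,k}:=\lambda_n-\frac{\lambda_k}2$, for $\omega\in\mathbb R$, $$K_{\mu,k}(\omega)=\sum_{n\ge1}\frac{\langle\mu,\varphi_n\rangle}{n}\left(\frac{\langle\mu,\varphi_{n+k}\rangle}{n+k}+\frac{\langle\mu,\varphi_{|n-k|}\rangle}{|n-k|}\mathbb 1_{n\ne k}\right)\frac{\lambda_{n,k}}{\lambda_{n,k}^2+\omega^2}.$$ *)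

(* Defs.v *)
From HB Require Import structures.
From mathcomp Require Export all_boot all_order all_algebra.
From mathcomp Require Export all_classical all_reals all_analysis.

Set Implicit Arguments.
Unset Strict Implicit.
Unset Printing Implicit Defensive.

Export Order.TTheory GRing.Theory Num.Theory.
Export numFieldNormedType.Exports.

Local Open Scope classical_set_scope.
Local Open Scope ring_scope.

(* The library declares no [filter_on] instance for +oo, and the Landau
   notations need one. *)
Canonical pinfty_filter_on (R : numFieldType) : filter_on R :=
  FilterType (pinfty_nbhs R) filter_filter.

Definition lam {R : realType} (j : nat) : R := (j%:R * pi) ^+ 2.

Definition phi {R : realType} (j : nat) : R -> R :=
  fun x => Num.sqrt 2 * sin (j%:R * pi * x).

Definition inner {R : realType} (f g : R -> R) : R :=
  \int[lebesgue_measure]_(x in `]0, 1[) (f x * g x).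

(* Functions on (0,1) are total functions R -> R of which only the values on
   ]0, 1[ matter. *)
Definition in_L2 {R : realType} (mu : R -> R) : Prop :=
  measurable_fun (`]0, 1[ : set R) mu /\
  lebesgue_measure.-integrable `]0, 1[ (fun x => (mu x ^+ 2)%:E).

Definition in_H {R : realType} (nu : R) (mu : R -> R) : Prop :=
  in_L2 mu /\
  (\sum_(1 <= j <oo) (lam j `^ nu * inner mu (phi j) ^+ 2)%:E < +oo)%E.

Definition lam2 {R : realType} (n k : nat) : R := lam n - lam k / 2.

(* [`|n - k|%N] is the distance between natural numbers, and the boolean
   [n != k] is used as the indicator; at n = k the quotient is x / 0 = 0. *)
Definition Kterm {R : realType} (mu : R -> R) (k : nat) (omega : R) (n : nat)
    : R :=
  inner mu (phi n) / n%:R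
  * (inner mu (phi (n + k)%N) / (n + k)%N%:R
     + inner mu (phi `|n - k|%N) / `|n - k|%N%:R * (n != k)%:R)
  * (lam2 n k / (lam2 n k ^+ 2 + omega ^+ 2)).

Definition Kfun {R : realType} (mu : R -> R) (k : nat) (omega : R) : R :=
  \big[+%R/0]_(1 <= n <oo) Kterm mu k omega n.

(* Main.v *)
Require Import Defs.
From mathcomp Require Import zify ring lra measurable_realfun.

Set Implicit Arguments.
Unset Strict Implicit.
Unset Printing Implicit Defensive.

Local Open Scope classical_set_scope.
Local Open Scope ring_scope.

(**
  Write a_n for the sine coefficient of mu, l_n for lambda_{n,k}, and c_n for
  the n-th term of K without its last factor l_n / (l_n^2 + w^2). Since
  w^2 l / (l^2 + w^2) = l - l * l^2 / (l^2 + w^2), multiplying K by w^2 gives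

    w^2 K(w) = sum_n c_n l_n - sum_n c_n l_n * l_n^2 / (l_n^2 + w^2).

  The proof evaluates the first sum and estimates the second.

  Evaluation. The product formula phi_n cos(k pi x) = (phi_{n+k} +- phi_{|n-k|}) / 2
  gives the sine coefficients of mu cos(k pi x), so Parseval's formula for the
  pair mu, mu cos(k pi x) writes the integral of mu^2 cos(k pi x) as a series
  in a_n a_{n+k} and a_n a_{|n-k|}. Up to the factor 2 pi^2 that series and
  sum_n c_n l_n have the same sum: their terms differ by a telescoping
  expression of step k ([lead_termE], [sum_defect]) whose boundary terms tend
  to 0. As phi_k' is a multiple of cos(k pi x), this is the announced constant
  ([lead_cvg]).

  Remainder. The quotient l^2 / (l^2 + w^2) lies in [0, 1], tends to 0 as w
  grows, and is at most (|l| / w)^nu for 0 <= nu <= 2 ([frac_le_powR]). Because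
  |l_n| is at most a constant times n (n + k), and times n |n - k| for n <> k,
  the sum of |c_n l_n| |l_n|^nu is controlled by that of lambda_n^nu a_n^2
  ([lead_weighted_sum]). With nu = 0 this is Bessel's inequality, and splitting
  the series at a large index yields the o; with the H^nu norm it yields the O.

  Parseval's formula ([parseval]) rests on the density of sine polynomials in
  L^2(0,1). The set of L^2-limits of sine polynomials is closed under dominated
  pointwise limits ([approximable_dominated]), and it is shown to contain larger
  and larger classes. If h is continuous, h(x) is a continuous function of
  t = (1 - cos(pi x)) / 2, hence the limit of its Bernstein polynomials in t, and
  sin(pi x) times a polynomial in cos(pi x) is a sine polynomial. This gives
  sin(pi x) h(x). Dividing by max(sin(pi x), 1/m) gives bounded continuous
  functions, density of continuous functions in L^1 gives bounded measurable
  ones, and truncation gives all of L^2.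
*)

(** * The inner product on square-integrable functions *)

Section L2.
Context {R : realType}.
Implicit Types f g h : R -> R.
Local Notation mu := (@lebesgue_measure R).
Local Notation D := (`]0, 1[%classic : set R).

Lemma unit_itv_lty : (mu D < +oo)%E.
Proof. by rewrite lebesgue_measure_itv/= lte_fin ltr01 -EFinB ltry. Qed.

Local Notation integrable01 f := (mu.-integrable D (EFin \o f)).

Lemma integrable01D f g : integrable01 f -> integrable01 g ->
  integrable01 (fun x => f x + g x).
Proof.
by move=> F G; have := @integrableD _ (measurableTypeR R) R mu D _ _ _ F G; apply.
Qed.

Lemma integrable01Z c f : integrable01 f -> integrable01 (fun x => c * f x).
Proof.
by move=> F; have := @integrableZl _ (measurableTypeR R) R mu D _ c _ F; apply.
Qed.

Lemma integrable01_le f g : measurable_fun D f -> integrable01 g ->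
  (forall x, D x -> `|f x| <= g x) -> integrable01 f.
Proof.
move=> mf G fg; apply: le_integrable G => //; first exact/measurable_EFinP.
by move=> x Dx; rewrite /= lee_fin (le_trans _ (ler_norm _)) ?fg.
Qed.

Lemma eq_integrable01 f g : (forall x, f x = g x) -> integrable01 f -> integrable01 g.
Proof. by move=> /funext ->. Qed.

Lemma L2_mul_integrable f g : in_L2 f -> in_L2 g -> integrable01 (fun x => f x * g x).
Proof.
move=> [mf f2] [mg g2]; apply: (@integrable01_le _ (fun x => f x ^+ 2 + g x ^+ 2)).
- exact: measurable_funM.
- exact: integrable01D.
move=> x _; rewrite normrM.
rewrite -(real_normK (num_real (f x))) -(real_normK (num_real (g x))).
by have := sqr_ge0 (`|f x| - `|g x|); have := sqr_ge0 (`|f x| + `|g x|); nra.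
Qed.

Lemma in_L2P f : measurable_fun D f -> integrable01 (fun x => f x * f x) -> in_L2 f.
Proof. by []. Qed.

Lemma in_L2Z c f : in_L2 f -> in_L2 (fun x => c * f x).
Proof.
move=> fL2; have [mf _] := fL2; apply: in_L2P; first exact: measurable_funM.
apply: eq_integrable01 (integrable01Z (c ^+ 2) (L2_mul_integrable fL2 fL2)) => x; ring.
Qed.

Lemma in_L2D f g : in_L2 f -> in_L2 g -> in_L2 (fun x => f x + g x).
Proof.
move=> fL2 gL2; have [mf _] := fL2; have [mg _] := gL2.
apply: in_L2P; first exact: measurable_funD.
apply: eq_integrable01 (integrable01D (L2_mul_integrable fL2 fL2) (integrable01D
  (L2_mul_integrable gL2 gL2) (integrable01Z 2 (L2_mul_integrable fL2 gL2)))) => x; ring.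
Qed.

Lemma in_L2_bounded f (M : R) : measurable_fun D f ->
  (forall x, D x -> `|f x| <= M) -> in_L2 f.
Proof.
move=> mf fM; split => //; apply: measurable_bounded_integrable => //.
- exact: unit_itv_lty.
- exact: measurable_funX.
- exists (M ^+ 2); split; rewrite ?num_real// => y My x Dx.
  by rewrite /= normrX (le_trans _ (ltW My))// lerXn2r ?nnegrE ?fM// (le_trans _ (fM x Dx)).
Qed.

Lemma in_L2_cst (c : R) : in_L2 (fun=> c).
Proof. by apply: (@in_L2_bounded _ `|c|). Qed.

Lemma in_L2_integrable f : in_L2 f -> integrable01 f.
Proof.
move=> fL2; apply: eq_integrable01 (L2_mul_integrable fL2 (in_L2_cst 1)) => x.
by rewrite mulr1.
Qed.

Lemma in_L2_le f g : measurable_fun D f -> in_L2 g ->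
  (forall x, D x -> `|f x| <= `|g x|) -> in_L2 f.
Proof.
move=> mf [mg g2] fg; split => //; apply: (@integrable01_le _ (fun x => g x ^+ 2)) => // [|x Dx].
  exact: measurable_funX.
rewrite normrX -(real_normK (num_real (g x))) lerXn2r ?nnegrE//; exact: fg.
Qed.

Lemma innerC f g : inner f g = inner g f.
Proof. by apply: eq_Rintegral => x _; rewrite mulrC. Qed.

Lemma eq_inner f f' g : (forall x, D x -> f x = f' x) -> inner f g = inner f' g.
Proof. by move=> e; apply: eq_Rintegral => x /set_mem Dx; rewrite e. Qed.

Lemma innerDl f g h : in_L2 f -> in_L2 g -> in_L2 h ->
  inner (fun x => f x + g x) h = inner f h + inner g h.
Proof.
move=> fL2 gL2 hL2; rewrite /inner -RintegralD//; try exact: L2_mul_integrable.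
by apply: eq_Rintegral => x _; rewrite mulrDl.
Qed.

Lemma innerZl c f g : in_L2 f -> in_L2 g -> inner (fun x => c * f x) g = c * inner f g.
Proof.
move=> fL2 gL2; rewrite /inner -RintegralZl//; last exact: L2_mul_integrable.
by apply: eq_Rintegral => x _; rewrite mulrA.
Qed.

Lemma inner_ge0 f : 0 <= inner f f.
Proof. by apply: Rintegral_ge0 => x _; rewrite -expr2 sqr_ge0. Qed.

Lemma in_L2_sum I (s : seq I) (F : I -> R -> R) (c : I -> R) : (forall i, in_L2 (F i)) ->
  in_L2 (fun x => \sum_(i <- s) c i * F i x).
Proof.
move=> FL2; elim: s => [|i s IH].
  by under eq_fun do rewrite big_nil; exact: in_L2_cst.
under eq_fun do rewrite big_cons.
by apply: in_L2D => //; exact: in_L2Z.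
Qed.

Lemma inner_suml I (s : seq I) (F : I -> R -> R) (c : I -> R) g :
  (forall i, in_L2 (F i)) -> in_L2 g ->
  inner (fun x => \sum_(i <- s) c i * F i x) g = \sum_(i <- s) c i * inner (F i) g.
Proof.
move=> FL2 gL2; elim: s => [|i s IH].
  rewrite big_nil /inner; under eq_Rintegral do rewrite big_nil mul0r.
  by rewrite Rintegral_cst// mul0r.
under [X in inner X _]eq_fun do rewrite big_cons.
rewrite innerDl//; [|exact: in_L2Z|exact: in_L2_sum].
by rewrite innerZl// IH big_cons.
Qed.

Lemma inner_line f g (t : R) : in_L2 f -> in_L2 g ->
  inner (fun x => f x + t * g x) (fun x => f x + t * g x) =
  inner f f + t * inner f g *+ 2 + t ^+ 2 * inner g g.
Proof.
move=> fL2 gL2; have tg := in_L2Z t gL2; have ftg := in_L2D fL2 tg.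
rewrite innerDl// innerZl// (innerC f) (innerC g) !innerDl// !innerZl//.
by rewrite (innerC g f); ring.
Qed.

(** The quadratic t |-> |f + t g|^2 is nonnegative; its value at the minimiser
    t = - <f, g> / <g, g> is the inequality. When <g, g> = 0 the function is
    affine and nonnegative, so its slope vanishes. *)
Lemma cauchy_schwarz f g : in_L2 f -> in_L2 g ->
  inner f g ^+ 2 <= inner f f * inner g g.
Proof.
move=> fL2 gL2.
have Q t : 0 <= inner f f + t * inner f g *+ 2 + t ^+ 2 * inner g g.
  by rewrite -inner_line// inner_ge0.
have := inner_ge0 f; have := inner_ge0 g.
move: Q; move: (inner f f) (inner g g) (inner f g) => a c b Q c0 a0.
have [c_eq|c_neq] := eqVneq c 0.
  have [->|bn] := eqVneq b 0; first by rewrite expr0n mulr_ge0.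
  have := Q (- (a + 1) / (b *+ 2)); rewrite c_eq mulr0 addr0.
  suff -> : a + - (a + 1) / (b *+ 2) * b *+ 2 = -1 by rewrite ler0N1.
  by field.
have cp : 0 < c by rewrite lt_def c_neq.
have := Q (- b / c).
suff -> : a + - b / c * b *+ 2 + (- b / c) ^+ 2 * c = (a * c - b ^+ 2) / c.
  by rewrite pmulr_lge0 ?invr_gt0// subr_ge0.
by field.
Qed.

End L2.

(** * The sine system *)

Section trig.
Context {R : realType}.
Implicit Types f g h : R -> R.
Local Notation mu := (@lebesgue_measure R).
Local Notation D := (`]0, 1[%classic : set R).

Lemma continuous_cosk m : continuous (fun x : R => cos (m%:R * pi * x)).
Proof.
move=> x; apply: (@continuous_comp _ _ _ (fun x => m%:R * pi * x) cos).
  exact: mulrl_continuous.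
exact: continuous_cos.
Qed.

Lemma continuous_sin_scale (c : R) : continuous (fun x => sin (c * x)).
Proof.
move=> x; apply: (@continuous_comp _ _ _ (fun x => c * x) sin).
  exact: mulrl_continuous.
exact: continuous_sin.
Qed.

Lemma continuous_phi j : continuous (@phi R j).
Proof.
move=> x; apply: (@continuous_comp _ _ _ _ (fun y => Num.sqrt 2 * y)).
  exact: continuous_sin_scale.
exact: mulrl_continuous.
Qed.

Lemma measurable_continuous f : continuous f -> measurable_fun D f.
Proof. by move=> cf; apply: measurable_funTS; exact: continuous_measurable_fun. Qed.

Lemma in_L2_phi j : in_L2 (@phi R j).
Proof.
apply: (@in_L2_bounded _ _ (Num.sqrt 2)); first exact: measurable_continuous (@continuous_phi j).
by move=> x _; rewrite normrM ger0_norm ?sqrtr_ge0// ler_piMr ?sqrtr_ge0 ?sin_max.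
Qed.

Lemma in_L2_cos m : in_L2 (fun x : R => cos (m%:R * pi * x)).
Proof.
apply: (@in_L2_bounded _ _ 1); first exact: measurable_continuous (@continuous_cosk m).
by move=> x _; exact: cos_max.
Qed.

Lemma in_L2_mul_cos f m : in_L2 f -> in_L2 (fun x => f x * cos (m%:R * pi * x)).
Proof.
move=> fL2; have [mf _] := fL2; apply: in_L2_le fL2 _.
  by apply: measurable_funM => //; exact: measurable_continuous (@continuous_cosk m).
by move=> x _; rewrite normrM ler_piMr ?cos_max.
Qed.

Lemma phi0 (x : R) : phi 0 x = 0.
Proof. by rewrite /phi !mul0r sin0 mulr0. Qed.

Lemma is_derive_sin_scale (c x : R) :
  is_derive x 1 (fun y => sin (c * y)) (c * cos (c * x)).
Proof.
rewrite mulrC; apply: (@is_derive1_comp R sin (fun y => c * y) x).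
by apply: is_derive_eq; rewrite /GRing.scale/= mulr1.
Qed.

Lemma sin_natpi m : sin (m%:R * pi) = 0 :> R.
Proof.
elim: m => [|m IH]; first by rewrite mul0r sin0.
by rewrite -natr1 mulrDl mul1r sinDpi IH oppr0.
Qed.

Lemma integral_cosk m : (0 < m)%N -> \int[mu]_(x in D) cos (m%:R * pi * x) = 0.
Proof.
move=> m0; have c0 : (m%:R * pi : R) != 0.
  by rewrite mulf_neq0 ?pnatr_eq0 -?lt0n// gt_eqF// pi_gt0.
set c := m%:R * pi in c0 *.
have dF (x : R) : is_derive x 1 (fun y => c^-1 * sin (c * y)) (cos (c * x)).
  have dsin := is_derive_sin_scale c x.
  by apply: is_derive_eq; rewrite /GRing.scale/= mulKf.
have cF : continuous (fun y : R => c^-1 * sin (c * y)).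
  by move=> x; apply: differentiable_continuous; apply/derivable1_diffP; case: (dF x).
rewrite /Rintegral -(integral_itv_bndoo true false); last first.
  apply/measurable_EFinP; exact: measurable_continuous (@continuous_cosk m).
rewrite (@continuous_FTC2 _ (fun x => cos (c * x)) (fun y => c^-1 * sin (c * y)))//.
- by rewrite !(mulr0, mulr1) sin_natpi sin0 mulr0 subee.
- by apply: continuous_subspaceT; exact: continuous_cosk.
- split.
  + by move=> x _; case: (dF x).
  + by apply: cvg_at_right_filter; exact: cF.
  + by apply: cvg_at_left_filter; exact: cF.
- by move=> x _; rewrite derive1E; case: (dF x).
Qed.

Lemma sin_mul_sin (a b : R) :
  Num.sqrt 2 * sin a * (Num.sqrt 2 * sin b) = cos (a - b) - cos (a + b).
Proof.
rewrite mulrACA -expr2 sqr_sqrtr// cosB cosD; ring.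
Qed.

Lemma Rintegral_D_cst (c : R) : \int[mu]_(x in D) c = c.
Proof.
rewrite Rintegral_cst//= [X in fine X]lebesgue_measure_itv/= lte_fin ltr01/=.
by rewrite oppr0 addr0 mulr1.
Qed.

Lemma inner_phi i j : (0 < i)%N -> inner (@phi R i) (phi j) = (i == j)%:R.
Proof.
have main a b : (0 < a)%N -> (a <= b)%N -> inner (@phi R a) (phi b) = (a == b)%:R.
  move=> a0 /subnKC <-; set d := (b - a)%N.
  have -> : inner (@phi R a) (phi (a + d)) =
    \int[mu]_(x in D) (cos (d%:R * pi * x) - cos ((a + (a + d))%:R * pi * x)).
    apply: eq_Rintegral => x _; rewrite sin_mul_sin; congr (_ - _).
      by rewrite -cosN; congr cos; rewrite natrD; ring.
    by congr cos; rewrite !natrD; ring.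
  have Ic m : mu.-integrable D (EFin \o (fun x : R => cos (m%:R * pi * x))).
    exact: in_L2_integrable (in_L2_cos m).
  rewrite RintegralB//.
  rewrite [X in _ - X]integral_cosk ?addn_gt0 ?a0// subr0.
  have [d0|d0] := posnP d; last first.
    by rewrite integral_cosk// -[X in X == _]addn0 eqn_add2l eq_sym gtn_eqF.
  rewrite d0 addn0 eqxx; under eq_Rintegral do rewrite !mul0r cos0.
  by rewrite Rintegral_D_cst.
move=> i0; have [ij|ji] := leqP i j; first exact: main.
have [->|j0] := posnP j.
  rewrite innerC (@eq_inner _ _ (fun=> 0)); last by move=> x _; rewrite phi0.
  rewrite /inner; under eq_Rintegral do rewrite mul0r.
  by rewrite Rintegral_D_cst gtn_eqF.
by rewrite innerC main ?(ltnW ji)// eq_sym.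
Qed.

(** The sign is that of n - k: it comes from sin being odd, and lets the index
    n - k be replaced by the distance between n and k. *)
Lemma phi_mul_cos n k (x : R) : phi n x * cos (k%:R * pi * x) =
  2^-1 * (phi (n + k)%N x + (-1) ^+ (n < k)%N * phi `|n - k|%N x).
Proof.
rewrite /phi natrD [(_ + _) * pi]mulrDl mulrDl sinD.
have [nk|kn] := ltnP n k.
  rewrite (_ : `|n - k|%N = (k - n)%N); last by lia.
  by rewrite natrB ?(ltnW nk)// !mulrBl sinB expr1; field.
rewrite (_ : `|n - k|%N = (n - k)%N); last by lia.
by rewrite natrB// !mulrBl sinB expr0; field.
Qed.

End trig.

(** * Sine polynomials and Bernstein averages *)

Section sinepoly.
Context {R : realType}.
Implicit Types f g h p q : R -> R.
Local Notation mu := (@lebesgue_measure R).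
Local Notation D := (`]0, 1[%classic : set R).

(** The sum is required for all large lengths M so that two sine polynomials can be
    written with the same number of terms. *)
Definition sine_poly p := exists (c : nat -> R) N, forall M, (N <= M)%N ->
  forall x, p x = \sum_(1 <= j < M) c j * phi j x.

Lemma sine_poly0 : sine_poly (fun=> 0).
Proof. by exists (fun=> 0), 0%N => M _ x; rewrite big1// => j _; rewrite mul0r. Qed.

Lemma sine_polyD p q : sine_poly p -> sine_poly q -> sine_poly (fun x => p x + q x).
Proof.
move=> [c [N pN]] [d [N' qN']]; exists (fun j => c j + d j), (maxn N N') => M.
rewrite geq_max => /andP[NM N'M] x; rewrite (pN _ NM) (qN' _ N'M) -big_split/=.
by apply: eq_bigr => j _; rewrite mulrDl.
Qed.

Lemma sine_polyZ a p : sine_poly p -> sine_poly (fun x => a * p x).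
Proof.
move=> [c [N pN]]; exists (fun j => a * c j), N => M NM x; rewrite (pN _ NM).
by rewrite mulr_sumr; apply: eq_bigr => j _; rewrite mulrA.
Qed.

Lemma eq_sine_poly p q : p =1 q -> sine_poly p -> sine_poly q.
Proof. by move=> /funext ->. Qed.

Lemma sine_poly_phi j : sine_poly (phi j).
Proof.
have [->|j0] := posnP j.
  by apply: eq_sine_poly sine_poly0 => x; rewrite phi0.
exists (fun i => (i == j)%:R), j.+1 => M jM x.
rewrite (bigD1_seq j) ?mem_index_iota ?j0 ?iota_uniq//= eqxx mul1r big1 ?addr0//.
by move=> i /negPf ->; rewrite mul0r.
Qed.

Lemma sine_poly_sum (s : seq nat) (c : nat -> R) (F : nat -> R -> R) :
  (forall j, sine_poly (F j)) -> sine_poly (fun x => \sum_(j <- s) c j * F j x).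
Proof.
move=> HF; elim: s => [|j s IH].
  by apply: eq_sine_poly sine_poly0 => x; rewrite big_nil.
apply: eq_sine_poly (sine_polyD (sine_polyZ (c j) (HF j)) IH) => x.
by rewrite big_cons.
Qed.

(** This closure makes sin(pi x) times any polynomial in cos(pi x) a sine
    polynomial. *)
Lemma sine_poly_mul_cos p : sine_poly p -> sine_poly (fun x => p x * cos (pi * x)).
Proof.
move=> [c [N pN]].
apply: (@eq_sine_poly (fun x => \sum_(1 <= j < N) c j * (phi j x * cos (1%:R * pi * x)))).
  by move=> x; rewrite (pN _ (leqnn N)) mulr_suml mul1r; apply: eq_bigr => j _; rewrite mulrA.
apply: sine_poly_sum => j.
apply: (@eq_sine_poly (fun x => 2^-1 * phi (j + 1)%N x +
  2^-1 * (-1) ^+ (j < 1)%N * phi `|j - 1|%N x)).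
  by move=> x; rewrite phi_mul_cos; ring.
by apply: sine_polyD; apply: sine_polyZ; exact: sine_poly_phi.
Qed.

(** The expectation of u at the number of successes in n independent trials of
    success probability t, that is the Bernstein polynomial of u. The recursion
    conditions on the first trial. *)
Fixpoint bern n (t : R) (u : nat -> R) : R :=
  if n is n'.+1 then t * bern n' t (u \o succn) + (1 - t) * bern n' t u else u 0%N.

Lemma sine_poly_bern n (u : nat -> R) p : sine_poly p ->
  sine_poly (fun x => p x * bern n ((1 - cos (pi * x)) / 2) u).
Proof.
elim: n u p => [|n IH] u p sp /=.
  by apply: eq_sine_poly (sine_polyZ (u 0%N) sp) => x; rewrite mulrC.
have spc := sine_poly_mul_cos sp.
have sp1 : sine_poly (fun x => p x * ((1 - cos (pi * x)) / 2)).
  by apply: eq_sine_poly (sine_polyD (sine_polyZ (2^-1) sp) (sine_polyZ (- 2^-1) spc)) => x; ring.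
have sp2 : sine_poly (fun x => p x * (1 - (1 - cos (pi * x)) / 2)).
  by apply: eq_sine_poly (sine_polyD (sine_polyZ (2^-1) sp) (sine_polyZ (2^-1) spc)) => x; field.
apply: eq_sine_poly (sine_polyD (IH (u \o succn) _ sp1) (IH u _ sp2)) => x; ring.
Qed.

Lemma ler_norm_bern n (t : R) u v : 0 <= t <= 1 ->
  (forall k, (k <= n)%N -> `|u k| <= v k) -> `|bern n t u| <= bern n t v.
Proof.
move=> /andP[t0 t1]; have t1' : 0 <= 1 - t by rewrite subr_ge0.
elim: n u v => [|n IH] u v uv /=; first exact: uv.
rewrite (le_trans (ler_normD _ _))// !normrM (ger0_norm t0) (ger0_norm t1').
rewrite lerD ?ler_wpM2l ?subr_ge0//; apply: IH => k kn; apply: uv => //.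
exact: leqW.
Qed.

Lemma bern_lin n (t : R) a b u v :
  bern n t (fun k => a * u k + b * v k) = a * bern n t u + b * bern n t v.
Proof.
elim: n u v => [|n IH] u v //=.
by rewrite IH (_ : _ \o _ = fun k => a * (u \o succn) k + b * (v \o succn) k)// IH; ring.
Qed.

Lemma bern_cst n (t a : R) : bern n t (fun=> a) = a.
Proof. by elim: n => [|n IH] //=; rewrite [_ \o _](_ : _ = fun=> a)// IH; ring. Qed.

Lemma bern_id n (t : R) : bern n t (fun k => k%:R) = n%:R * t.
Proof.
elim: n => [|n IH] /=; first by rewrite mul0r.
rewrite [_ \o _](_ : _ = fun k => 1 * k%:R + 1 * (fun=> 1) k); last first.
  by apply/funext => k /=; rewrite !mul1r natr1.
by rewrite bern_lin IH bern_cst -natr1; ring.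
Qed.

Lemma bern_sqr n (t : R) :
  bern n t (fun k => k%:R ^+ 2) = n%:R ^+ 2 * t ^+ 2 + n%:R * t * (1 - t).
Proof.
elim: n => [|n IH] /=; first by rewrite expr0n !mul0r addr0.
rewrite [_ \o _](_ : _ = fun k => 1 * k%:R ^+ 2 + 1 * (fun k => 2 * k%:R + 1 * (fun=> 1) k) k); last first.
  by apply/funext => k /=; rewrite !mul1r -natr1; ring.
by rewrite !bern_lin IH bern_id bern_cst -natr1; ring.
Qed.

(** Variance of a binomial frequency; it drives the convergence of Bernstein
    polynomials. *)
Lemma bern_var n (t : R) :
  bern n.+1 t (fun k => (k%:R / n.+1%:R - t) ^+ 2) = t * (1 - t) / n.+1%:R.
Proof.
have n0 : n.+1%:R != 0 :> R by rewrite pnatr_eq0.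
rewrite (_ : (fun k => _) = fun k => n.+1%:R ^- 2 * k%:R ^+ 2 +
   1 * (fun k => (- 2 * t / n.+1%:R) * k%:R + t ^+ 2 * (fun=> 1) k) k); last first.
  by apply/funext => k; field; rewrite addrC natr1.
by rewrite !bern_lin bern_sqr bern_id bern_cst; field; rewrite addrC natr1.
Qed.

(** Chebyshev's argument: near t the increment of w is small by continuity,
    and away from t it is at most a multiple of (s - t)^2, whose average is the
    variance t (1 - t) / n. Only continuity at the point t is used, so the
    convergence is pointwise. *)
Lemma bern_cvg (w : R -> R) M t : 0 <= t <= 1 ->
  (forall s, 0 <= s <= 1 -> `|w s| <= M) -> {for t, continuous w} ->
  bern n.+1 t (fun k => w (k%:R / n.+1%:R)) @[n --> \oo] --> w t.
Proof.
move=> t01 wM cw; have M0 : 0 <= M by apply: le_trans (wM t t01).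
apply/cvgrPdist_le => e e0.
have e20 : 0 < e / 2 by rewrite divr_gt0.
move/cvgrPdist_le: cw => /(_ _ e20)/nbhs_ballP[d /= d0 dw].
pose C := 2 * M / d ^+ 2.
(* For |s - t| >= d the increment is at most 2 M, hence at most C (s - t)^2. *)
have C0 : 0 <= C by apply: divr_ge0; [exact: mulr_ge0 | exact: sqr_ge0].
have key s : 0 <= s <= 1 -> `|w t - w s| <= e / 2 + C * (s - t) ^+ 2.
  move=> s01; have [ts|ts] := ltrP `|t - s| d.
    by rewrite (le_trans (dw s ts))// lerDl mulr_ge0// sqr_ge0.
  apply: (@le_trans _ _ (2 * M)).
    by rewrite (le_trans (ler_normB _ _))// mulr2n mulrDl mul1r lerD// wM.
  rewrite -[leLHS]add0r lerD// ?(ltW e20)// /C mulrAC ler_pdivlMr ?exprn_gt0//.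
  rewrite ler_wpM2l ?mulr_ge0// -(real_normK (num_real (s - t))) distrC.
  by rewrite lerXn2r ?nnegrE// ltW.
near=> n.
have n0 : 0 < n.+1%:R :> R by rewrite ltr0n.
rewrite (_ : w t - _ = bern n.+1 t (fun k => 1 * (fun=> w t) k + -1 * w (k%:R / n.+1%:R))); last first.
  by rewrite bern_lin bern_cst mul1r mulN1r.
have V : bern n.+1 t (fun k => 1 * (fun=> e / 2) k + C * (fun k => (k%:R / n.+1%:R - t) ^+ 2) k) <= e.
  rewrite bern_lin bern_cst bern_var mul1r [leRHS]splitr lerD2l.
  apply: (@le_trans _ _ (C / n.+1%:R)).
    rewrite ler_wpM2l// ler_pdivrMr// mulVf ?gt_eqF//.
    by case/andP: t01 => ? ?; nra.
  rewrite ler_pdivrMr// mulrC -ler_pdivrMr//.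
  rewrite (le_trans (ltW (near (nbhs_infty_gtr (C / (e/2))) n _)))//.
  by rewrite ler_nat.
apply: le_trans V; apply: ler_norm_bern => // k kn.
rewrite !mul1r mulN1r; apply: key.
by rewrite divr_ge0//= ler_pdivrMr// mul1r ler_nat.
Unshelve. all: by end_near. Qed.

End sinepoly.

(** * Completeness of the sine system and Parseval's formula *)

Section density.
Context {R : realType}.
Implicit Types f g h p q : R -> R.
Local Notation mu := (@lebesgue_measure R).
Local Notation D := (`]0, 1[%classic : set R).

Lemma in_L2B f g : in_L2 f -> in_L2 g -> in_L2 (fun x => f x - g x).
Proof.
move=> fL2 gL2; have := in_L2D fL2 (in_L2Z (-1) gL2).
by under eq_fun do rewrite mulN1r.
Qed.

Definition dist2 f g := inner (fun x => f x - g x) (fun x => f x - g x).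

Lemma dist2_triangle f g h : in_L2 f -> in_L2 g -> in_L2 h ->
  dist2 f h <= 2 * dist2 f g + 2 * dist2 g h.
Proof.
move=> fL2 gL2 hL2; have fg := in_L2B fL2 gL2; have gh := in_L2B gL2 hL2.
have /(@inner_line _ _ _ 1 fg) := gh; have /(@inner_line _ _ _ (-1) fg) := gh.
rewrite -/(dist2 f g) -/(dist2 g h).
under eq_fun do rewrite mulN1r.
have -> : (fun x => f x - g x + 1 * (g x - h x)) = (fun x => f x - h x).
  by apply/funext => x; ring.
rewrite -/(dist2 f h).
have := inner_ge0 (fun x => f x - g x + - (g x - h x)).
lra.
Qed.

Lemma sine_poly_in_L2 p : sine_poly p -> in_L2 p.
Proof.
move=> [c [N pN]]; rewrite (funext (pN _ (leqnn N))).
by apply: in_L2_sum => j; exact: in_L2_phi.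
Qed.

Definition approximable f := in_L2 f /\
  forall e, 0 < e -> exists2 p, sine_poly p & dist2 f p < e.

Lemma approximable_sine_poly p : sine_poly p -> approximable p.
Proof.
move=> sp; split; first exact: sine_poly_in_L2.
move=> e e0; exists p => //; rewrite /dist2 /inner.
by under eq_Rintegral do rewrite subrr mul0r; rewrite Rintegral_D_cst.
Qed.

Lemma approximable_closed f : in_L2 f ->
  (forall e, 0 < e -> exists2 g, approximable g & dist2 f g < e) -> approximable f.
Proof.
move=> fL2 fg; split => // e e0.
have e4 : 0 < e / 4 by rewrite divr_gt0.
have [g [gL2 gp] fge] := fg _ e4; have [p sp gpe] := gp _ e4.
exists p => //; apply: le_lt_trans (dist2_triangle fL2 gL2 (sine_poly_in_L2 sp)) _.
lra.
Qed.

(** By dominated convergence a dominated pointwise limit is an L^2 limit. *)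
Lemma approximable_dominated (f_ : nat -> R -> R) f G : (forall n, approximable (f_ n)) ->
  measurable_fun D f -> in_L2 G ->
  (forall n x, D x -> `|f_ n x| <= G x) ->
  (forall x, D x -> f_ n x @[n --> \oo] --> f x) -> approximable f.
Proof.
move=> f_a mf GL2 f_G f_f.
have fG x : D x -> `|f x| <= G x.
  move=> Dx; apply: (cvgr_to_le (cvg_norm (f_f x Dx))).
  by apply: nearW => n; exact: f_G.
have fL2 : in_L2 f.
  by apply: in_L2_le GL2 _ => // x Dx; rewrite (le_trans (fG x Dx))// ler_norm.
apply: approximable_closed => // e e0.
have f_L2 n : in_L2 (f_ n) by case: (f_a n).
have dL2 n := in_L2B fL2 (f_L2 n).
pose h n x := ((f x - f_ n x) * (f x - f_ n x))%:E.
have IG : mu.-integrable D (fun x => (4 * (G x * G x))%:E).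
  exact: integrable01Z (L2_mul_integrable GL2 GL2).
have := @dominated_convergence _ _ R mu D _ h (cst 0%E) (fun x => (4 * (G x * G x))%:E) _ _ _ IG _.
case => //.
- move=> n; exact: measurable_int (L2_mul_integrable (dL2 n) (dL2 n)).
- apply: aeW => x Dx; rewrite /h; apply: cvg_EFin.
    by apply: nearW.
  rewrite [X in _ --> X](_ : _ = (f x - f x) * (f x - f x)); last by rewrite subrr mul0r.
  by apply: cvgM; apply: cvgB; [exact: cvg_cst|exact: f_f|exact: cvg_cst|exact: f_f].
- apply: aeW => x n Dx; rewrite /h /= lee_fin ger0_norm -?expr2 ?sqr_ge0//.
  have := fG x Dx; have := f_G n x Dx; rewrite !ler_norml => /andP[? ?] /andP[? ?].
  nra.
move=> _ _; rewrite integral0 => /fine_cvgP[_] /cvgrPdist_lt/(_ _ e0) [N _ /(_ _ (leqnn N))].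
rewrite /= sub0r normrN => hN; exists (f_ N) => //.
exact: le_lt_trans (ler_norm _) hN.
Qed.

Lemma pi_mul_itv (x : R) : D x -> 0 < pi * x < pi.
Proof.
rewrite /= in_itv/= => /andP[x0 x1]; rewrite mulr_gt0 ?pi_gt0//=.
by rewrite gtr_pMr ?pi_gt0.
Qed.

(** The change of variable t = (1 - cos(pi x)) / 2 turns w into
    W(t) = w(acos(1 - 2 t) / pi), and the Bernstein polynomials of W in t,
    multiplied by sin(pi x), are sine polynomials. Continuity of W is needed at
    interior points only, where acos is continuous. *)
Lemma approximable_sin_mul (w : R -> R) M : measurable_fun D w ->
  (forall x, 0 <= x <= 1 -> `|w x| <= M) ->
  (forall x, D x -> {for x, continuous w}) ->
  approximable (fun x => sin (pi * x) * w x).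
Proof.
move=> mw wM cw.
have pi0 : (pi : R) != 0 by rewrite gt_eqF// pi_gt0.
pose W (s : R) := w (acos (1 - 2 * s) / pi).
pose f_ n x := sin (pi * x) * bern n.+1 ((1 - cos (pi * x)) / 2) (fun k => W (k%:R / n.+1%:R)).
have WM s : 0 <= s <= 1 -> `|W s| <= M.
  move=> /andP[s0 s1]; have s01 : -1 <= 1 - 2 * s <= 1 by apply/andP; split; lra.
  by apply: wM; rewrite divr_ge0 ?acos_ge0 ?pi_ge0//= ler_pdivrMr ?pi_gt0// mul1r acos_lepi.
have cos01 x : 0 <= (1 - cos (pi * x : R)) / 2 <= 1.
  by have := cos_geN1 (pi * x); have := cos_le1 (pi * x) => *; apply/andP; split; lra.
apply: (@approximable_dominated f_ _ (fun=> M)) => //.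
- move=> n; apply: approximable_sine_poly; apply: sine_poly_bern.
  apply: (@eq_sine_poly _ (fun x => (Num.sqrt 2)^-1 * phi 1 x)).
    by move=> x; rewrite /phi mul1r mulKf// gt_eqF// sqrtr_gt0.
  by apply: sine_polyZ; exact: sine_poly_phi.
- apply: measurable_funM => //; apply: measurable_continuous.
  exact: continuous_sin_scale.
- exact: in_L2_cst.
- move=> n x Dx; rewrite normrM -[leRHS]mul1r ler_pM ?sin_max//.
  rewrite -(bern_cst n.+1 ((1 - cos (pi * x)) / 2) M); apply: ler_norm_bern => // k kn.
  by apply: WM; rewrite divr_ge0//= ler_pdivrMr ?ltr0n// mul1r ler_nat.
- move=> x Dx; apply: cvgM; first exact: cvg_cst.
  have /andP[p0 p1] := pi_mul_itv Dx.
  have acx : acos (1 - 2 * ((1 - cos (pi * x)) / 2)) = pi * x.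
    rewrite (_ : 1 - _ = cos (pi * x)); last by field.
    by rewrite cosK// in_itv/= !ltW.
  have Wx : W ((1 - cos (pi * x)) / 2) = w x.
    by rewrite /W acx mulrAC divff// mul1r.
  rewrite -Wx; apply: bern_cvg WM _ => //.
  apply: (@continuous_comp R R R (fun s => acos (1 - 2 * s) / pi) w); last first.
    by rewrite acx mulrAC divff// mul1r; exact: cw.
  apply: (@continuous_comp R R R (fun s => acos (1 - 2 * s)) (fun y => y / pi)).
    2: exact: mulrr_continuous.
  apply: (@continuous_comp R R R (fun s => 1 - 2 * s) (@acos R)).
    by apply: cvgB; [exact: cvg_cst|exact: mulrl_continuous].
  apply: continuous_acos; rewrite (_ : 1 - _ = cos (pi * x)); last by field.
  apply/andP; split.
    by rewrite -cospi ltr_cos ?in_itv/= ?lexx ?pi_ge0// !ltW.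
  by rewrite -cos0 ltr_cos ?in_itv/= ?lexx ?pi_ge0// !ltW.
Qed.

(** Write g as sin(pi x) * (g(x) / sin(pi x)); the denominator is bounded below
    by 1 / (n + 1) to keep the quotient continuous at the end points, and this
    modification disappears in the limit. *)
Lemma approximable_continuous g M :
  continuous g -> (forall x, `|g x| <= M) -> approximable g.
Proof.
move=> cg gM.
pose s x : R := sin (pi * x).
have cs : continuous s by exact: continuous_sin_scale.
have s0 x : D x -> 0 < s x by move=> /pi_mul_itv; exact: sin_gt0_pi.
pose m n x := Num.max (s x) n.+1%:R^-1.
have m0 n x : 0 < m n x by rewrite lt_max invr_gt0 ltr0n orbT.
have cm n : continuous (m n).
  by move=> x; apply: (@continuous_max _ _ s (fun=> n.+1%:R^-1)); [exact: cs|exact: cst_continuous].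
have cw n : continuous (fun x => g x / m n x).
  by move=> x; apply: cvgM; [exact: cg|apply: cvgV; [rewrite gt_eqF|exact: cm]].
apply: (@approximable_dominated (fun n x => s x * (g x / m n x)) _ (fun=> M)) => //.
- move=> n; apply: (@approximable_sin_mul _ (M * n.+1%:R)).
  + exact: measurable_continuous.
  + move=> x _; rewrite normrM ler_pM// normfV gtr0_norm// -[leRHS]invrK lef_pV2 ?posrE// ?invr_gt0 ?ltr0n//.
    by rewrite le_max lexx orbT.
  + by move=> x _; exact: cw.
- exact: measurable_continuous.
- exact: in_L2_cst.
- move=> n x Dx; rewrite mulrCA normrM -[leRHS]mulr1 ler_pM//.
  rewrite ger0_norm; last by rewrite divr_ge0// ltW// s0.
  by rewrite ler_pdivrMr// mul1r le_max lexx.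
- move=> x Dx; apply: cvg_near_cst; near=> n.
  have le_s : n.+1%:R^-1 <= s x.
    rewrite -[leRHS]invrK lef_pV2 ?posrE ?invr_gt0 ?s0 ?ltr0n//.
    apply: (le_trans (ltW (near (nbhs_infty_gtr (s x)^-1) n _))) => //.
    by rewrite ler_nat.
  have -> : m n x = s x by rewrite /m max_l.
  by rewrite mulrC divfK// gt_eqF// s0.
Unshelve. all: by end_near. Qed.

Definition clip (M y : R) := Num.max (- M) (Num.min M y).

Lemma clip_norm M y : 0 <= M -> `|clip M y| <= M.
Proof.
move=> M0; rewrite /clip ler_norml le_max lexx/= ge_max ge_min lexx/= andbT; lra.
Qed.

Lemma clip_id M y : `|y| <= M -> clip M y = y.
Proof. by rewrite /clip ler_norml => /andP[My yM]; rewrite min_r// max_r. Qed.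

Lemma clip_norm_le M y : 0 <= M -> `|clip M y| <= `|y|.
Proof.
move=> M0; have [yM|My] := leP `|y| M; first by rewrite clip_id.
exact: le_trans (clip_norm y M0) (ltW My).
Qed.

Lemma clip_contract M y z : `|y| <= M -> `|y - clip M z| <= `|y - z|.
Proof.
move=> yM; have := yM; rewrite ler_norml => /andP[My yM'].
have [zM|Mz] := leP `|z| M; first by rewrite clip_id.
rewrite /clip; have [z0|z0] := leP 0 z.
  rewrite ger0_norm// in Mz; rewrite min_l ?(ltW Mz)// max_r; last lra.
  by rewrite ler0_norm ?ler0_norm; lra.
rewrite ltr0_norm// in Mz; rewrite min_r; last lra.
by rewrite max_l; [rewrite !ger0_norm; lra|lra].
Qed.

(** Density of continuous functions in L^1 suffices: once the approximation g
    is clipped to [-M, M], the square (f - g)^2 is at most 2 M |f - g|. *)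
Lemma approximable_bounded f M : measurable_fun D f -> (forall x, D x -> `|f x| <= M) ->
  approximable f.
Proof.
move=> mf fM; have fL2 := in_L2_bounded mf fM.
apply: approximable_closed => // e e0.
have M0 : 0 <= M.
  have : D (2^-1) by rewrite /= in_itv/=; apply/andP; split; lra.
  by move/fM; apply: le_trans.
have If := in_L2_integrable fL2.
have [g_ [cg ig g0]] := approximation_continuous_integrable (measurable_itv _) unit_itv_lty If.
pose d : R := e / (2 * M + 1).
have d0 : 0 < d by rewrite divr_gt0// ltr_wpDl// mulr_ge0.
move/fine_cvgP : g0 => [_] /cvgrPdist_lt/(_ _ d0) [N _ /(_ _ (leqnn N))].
rewrite /= sub0r normrN => gN.
exists (clip M \o g_ N).
  apply: (@approximable_continuous _ M); last by move=> x; exact: clip_norm.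
  move=> x; apply: (@continuous_max _ _ (fun=> - M) (fun x => Num.min M (g_ N x))).
    exact: cst_continuous.
  apply: (@continuous_min _ _ (fun=> M) (g_ N)); last exact: cg.
  exact: cst_continuous.
have mg : measurable_fun D (g_ N) by exact: measurable_continuous (cg N).
have mc : measurable_fun D (clip M \o g_ N).
  by apply: measurable_maxr => //; apply: measurable_minr.
have cL2 : in_L2 (clip M \o g_ N).
  by apply: (in_L2_bounded mc (M := M)) => x _; exact: clip_norm.
have Ifg : mu.-integrable D (EFin \o (fun x => `|f x - g_ N x|)).
  have IN : mu.-integrable D (EFin \o g_ N) := ig N.
  apply: (@integrable01_le _ _ (fun x => `|f x| + `|g_ N x|)).
  - by apply: measurableT_comp => //; exact: measurable_funB.
  - by apply: integrable01D; exact: integrable_norm.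
  - by move=> x _; rewrite normr_id ler_normB.
have bnd : dist2 f (clip M \o g_ N) <= (2 * M + 1) * \int[mu]_(x in D) `|f x - g_ N x|.
  rewrite -RintegralZl//; apply: le_Rintegral => //.
  - exact: L2_mul_integrable (in_L2B fL2 cL2) (in_L2B fL2 cL2).
  - exact: integrable01Z.
  - move=> x Dx /=; have := clip_contract (g_ N x) (fM x Dx).
    have := fM x Dx; have := clip_norm (g_ N x) M0.
    have := normr_ge0 (f x - g_ N x).
    rewrite -expr2 -(real_normK (num_real (f x - _))).
    have := ler_normB (f x) (clip M (g_ N x)).
    by have := normr_ge0 (f x - clip M (g_ N x)); nra.
apply: (le_lt_trans bnd); rewrite mulrC -ltr_pdivlMr ?ltr_wpDl ?mulr_ge0//.
exact: le_lt_trans (ler_norm _) gN.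
Qed.

Lemma approximable_L2 f : in_L2 f -> approximable f.
Proof.
move=> fL2; have [mf _] := fL2.
apply: (@approximable_dominated (fun n x => clip n%:R (f x)) _ (fun x => `|f x|)) => //.
- move=> n; apply: (@approximable_bounded _ n%:R); last by move=> x _; exact: clip_norm.
  by apply: measurable_maxr => //; apply: measurable_minr.
- by apply: in_L2_le fL2 _ => [|x _]; [exact: measurableT_comp|rewrite normr_id].
- by move=> n x _; exact: clip_norm_le.
- move=> x _; apply: cvg_near_cst; near=> n; apply: clip_id.
  by near: n; exact: nbhs_infty_ger.
Unshelve. all: by end_near. Qed.

Lemma proj_orthogonal f N (c : nat -> R) : in_L2 f ->
  inner (fun x => f x - \sum_(1 <= j < N) inner f (phi j) * phi j x)
        (fun x => \sum_(1 <= j < N) c j * phi j x) = 0.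
Proof.
move=> fL2; have pL2 := @in_L2_phi R.
rewrite innerC inner_suml//; last by apply: in_L2B => //; exact: in_L2_sum.
rewrite big_nat big1// => j /andP[j1 jN].
rewrite innerC (_ : (fun x => _) = fun x => f x + \sum_(1 <= i < N) - inner f (phi i) * phi i x); last first.
  by apply/funext => x; under [in RHS]eq_bigr do rewrite mulNr; rewrite sumrN.
rewrite innerDl//; last exact: in_L2_sum.
rewrite inner_suml// (bigD1_seq j) ?mem_index_iota ?j1 ?iota_uniq//=.
rewrite big_nat_cond big1 => [|i /andP[/andP[i1 _] /negPf ij]]; last first.
  by rewrite inner_phi// ij mulr0.
by rewrite inner_phi// eqxx mulr1 addr0 subrr mulr0.
Qed.

(** Pythagoras: the partial sum of the sine series is at least as close to f as any
    other sine polynomial of the same length. *)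
Lemma proj_best f N (c : nat -> R) : in_L2 f ->
  dist2 f (fun x => \sum_(1 <= j < N) inner f (phi j) * phi j x) <=
  dist2 f (fun x => \sum_(1 <= j < N) c j * phi j x).
Proof.
move=> fL2; have pL2 := @in_L2_phi R.
set S := fun x => \sum_(1 <= j < N) inner f (phi j) * phi j x.
pose q x := \sum_(1 <= j < N) (inner f (phi j) - c j) * phi j x.
have SL2 : in_L2 S by exact: in_L2_sum.
have qL2 : in_L2 q by exact: in_L2_sum.
rewrite [leRHS](_ : _ = inner (fun x => (f x - S x) + 1 * q x) (fun x => (f x - S x) + 1 * q x)).
  rewrite inner_line//; last exact: in_L2B.
  by rewrite proj_orthogonal// mulr0 mul0rn addr0 expr1n mul1r lerDl inner_ge0.
rewrite /dist2; congr inner; apply/funext => x; rewrite mul1r /q /S;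
  under [X in _ = _ + X]eq_bigr do rewrite mulrBl; rewrite sumrB; ring.
Qed.

(** The error of the partial sum is the inner product of f minus its projection
    with g, so Cauchy-Schwarz reduces the claim to the convergence of the
    projections, that is to density. *)
Lemma parseval f g : in_L2 f -> in_L2 g ->
  \sum_(1 <= n < N) inner f (phi n) * inner g (phi n) @[N --> \oo] --> inner f g.
Proof.
move=> fL2 gL2; have pL2 := @in_L2_phi R.
apply/cvgrPdist_le => e e0.
have [_ fa] := approximable_L2 fL2.
pose d := e ^+ 2 / (inner g g + 1).
have gg1 : 0 < inner g g + 1 by rewrite ltr_wpDl ?inner_ge0.
have d0 : 0 < d by rewrite divr_gt0 ?exprn_gt0.
have [p [c [N0 pN]] fp] := fa _ d0.
exists N0 => // N /= N0N.
pose S x := \sum_(1 <= j < N) inner f (phi j) * phi j x.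
have SL2 : in_L2 S by exact: in_L2_sum.
have fS : dist2 f S <= d.
  apply: (le_trans (proj_best N c fL2)).
  by rewrite -(funext (pN _ N0N)) ltW.
have -> : inner f g - \sum_(1 <= n < N) inner f (phi n) * inner g (phi n) =
    inner (fun x => f x - S x) g.
  rewrite (_ : (fun x => f x - S x) = fun x => f x + (-1) * S x); last first.
    by apply/funext => x; rewrite mulN1r.
  rewrite innerDl// ?innerZl ?inner_suml//; last exact: in_L2Z.
  by rewrite mulN1r; congr (_ - _); apply: eq_bigr => n _; rewrite (innerC g).
rewrite -(@ler_pXn2r _ 2)// ?nnegrE ?(ltW e0)// real_normK ?num_real//.
apply: (le_trans (cauchy_schwarz (in_L2B fL2 SL2) gL2)).
apply: (@le_trans _ _ (d * (inner g g + 1))); last by rewrite divfK ?gt_eqF.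
by rewrite ler_pM ?inner_ge0// lerDl.
Qed.

End density.

(** * The series of coefficients *)

Section series.
Context {R : realType}.
Context (a : nat -> R) (k : nat) (a0 : a 0%N = 0) (k0 : (0 < k)%N).

(** The limit of w^2 times the n-th term of K. *)
Definition lead_term n : R :=
  a n / n%:R * (a (n + k)%N / (n + k)%N%:R + a `|n - k|%N / `|n - k|%N%:R * (n != k)%:R)
  * lam2 n k.

(** The n-th sine coefficient of mu cos(k pi x) when a is the sequence of sine
    coefficients of mu. *)
Definition cos_coeff n : R :=
  2^-1 * (a (n + k)%N + (-1) ^+ (n < k)%N * a `|n - k|%N).

(** The excess of the a_n a_{n+k} part of [lead_term] over that of
    2 pi^2 a_n [cos_coeff] is - pi^2 [defectr]; for the a_n a_{|n-k|} part the
    excess is pi^2 [defectl]. *)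
Definition defectr n : R :=
  k%:R * (n%:R + k%:R / 2) * (a n / n%:R) * (a (n + k)%N / (n + k)%N%:R).

Definition defectl n : R :=
  k%:R * (n%:R - k%:R / 2) * (a n / n%:R) * (a `|n - k|%N / `|n - k|%N%:R).

Lemma nat_neq0 n : (0 < n)%N -> n%:R != 0 :> R.
Proof. by rewrite pnatr_eq0 -lt0n. Qed.

(** Both shifted products in the term carry the weight lambda_{n,k}; replacing it
    by pi^2 n (n + k), respectively pi^2 n (n - k), leaves the coefficient of
    mu cos(k pi x) and the two defects. *)
Lemma lead_termE n : (0 < n)%N ->
  lead_term n = 2 * pi ^+ 2 * (a n * cos_coeff n) + pi ^+ 2 * (defectl n - defectr n).
Proof.
move=> n0; rewrite /lead_term /cos_coeff /defectl /defectr /lam2 /lam.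
have nn := nat_neq0 n0; have nk : (n + k)%:R != 0 :> R by rewrite nat_neq0// addn_gt0 n0.
have [->|n_k] := eqVneq n k.
  rewrite distnn a0 ltnn !mul0r !mulr0 !addr0 !natrD; field.
  by have := nat_neq0 k0 => kk; rewrite kk/= -natrD nat_neq0// addn_gt0 k0.
have d0 : `|n - k|%:R != 0 :> R by rewrite nat_neq0//; lia.
have sg : (-1) ^+ (n < k)%N * `|n - k|%:R = n%:R - k%:R :> R.
  have [lt|le] := ltnP n k.
    by rewrite (_ : `|n - k|%N = (k - n)%N); [rewrite natrB ?(ltnW lt)//; ring|lia].
  by rewrite (_ : `|n - k|%N = (n - k)%N); [rewrite natrB//; ring|lia].
have -> : (-1) ^+ (n < k)%N = (n%:R - k%:R) / `|n - k|%:R :> R by rewrite -sg mulfK.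
move: (a `|n - k|%N) `|n - k|%N d0 {sg} => a' d d0.
rewrite mulr1; rewrite natrD in nk *.
by field; rewrite d0 nk nn.
Qed.

Lemma defectl_shift n : defectl (n + k)%N = defectr n.
Proof.
rewrite /defectl /defectr (_ : `|n + k - k|%N = n); last lia.
by move: (a n / _) (a (n + k)%N / _) => x y; rewrite natrD; field.
Qed.

Lemma defectr0 : defectr 0 = 0.
Proof. by rewrite /defectr a0 !mul0r mulr0 mul0r. Qed.

(** The term is antisymmetric under n |-> k - n. *)
Lemma sum_defectl0 : \sum_(0 <= n < k) defectl n = 0.
Proof.
(* The term n = k vanishes; including it makes the range symmetric. *)
have anti : \sum_(0 <= n < k.+1) defectl n = - \sum_(0 <= n < k.+1) defectl n.
  rewrite {1}big_nat_rev/= add0n -sumrN; apply: eq_big_nat => n /andP[_ nk].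
  rewrite /defectl subSS (_ : `|k - n - k|%N = n); last lia.
  rewrite (_ : `|n - k|%N = (k - n)%N); last lia.
  by move: (a n / _) (a (k - n)%N / _) => x y; rewrite natrB//; field.
have kk : defectl k = 0 by rewrite -[k]add0n defectl_shift defectr0.
move: anti; rewrite big_nat_recr//= kk addr0 => /eqP.
by rewrite -addr_eq0 -mulr2n mulrn_eq0/= => /eqP.
Qed.

(** Since the left defect at n + k is the right defect at n, the sum telescopes with step k and
    leaves a window of fixed length k. *)
Lemma sum_defect M :
  \sum_(0 <= n < M + k) (defectl n - defectr n) = - \sum_(0 <= j < k) defectr (M + j)%N.
Proof.
elim: M => [|M IH].
  by rewrite add0n sumrB sum_defectl0 sub0r; congr (- _).
rewrite addSn big_nat_recr//= IH defectl_shift.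
have E : \sum_(0 <= j < k.+1) defectr (M + j)%N = defectr M + \sum_(0 <= j < k) defectr (M.+1 + j)%N.
  rewrite big_nat_recl// addn0; congr (_ + _).
  by apply: eq_bigr => j _; rewrite addnS.
have E' : \sum_(0 <= j < k.+1) defectr (M + j)%N = \sum_(0 <= j < k) defectr (M + j)%N + defectr (M + k)%N.
  by rewrite big_nat_recr.
move: E E'; move: (\sum_(0 <= j < k.+1) _) => S -> /eqP; lra.
Qed.

(** The weight k (n + k/2) / (n (n + k)) is of order 1/n. *)
Lemma defectr_cvg0 B : (forall n, `|a n| <= B) -> defectr n @[n --> \oo] --> 0.
Proof.
move=> aB; have B0 : 0 <= B by apply: le_trans (aB 0%N).
apply/cvgr0Pnorm_le => e e0; near=> n.
have n0 : (0 < n)%N by near: n; exists 1%N.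
have np : 0 < n%:R :> R by rewrite ltr0n.
have kp : 0 < k%:R :> R by rewrite ltr0n.
have nkp : 0 < (n + k)%:R :> R by rewrite ltr0n addn_gt0 n0.
have h1 : `|a n| / n%:R <= B / n%:R by rewrite ler_pM2r ?invr_gt0.
have h2 : (n%:R + k%:R / 2) * (`|a (n + k)%N| / (n + k)%:R) <= B.
  rewrite mulrA ler_pdivrMr// mulrC ler_pM// ?natrD; lra.
have -> : `|defectr n| = k%:R *
    ((n%:R + k%:R / 2) * (`|a (n + k)%N| / (n + k)%:R) * (`|a n| / n%:R)).
  rewrite /defectr !normrM !normfV !normr_nat (@ger0_norm _ (n%:R + _)); last lra.
  by move: (_^-1) (_^-1) (_^-1) => x y z; ring.
apply: (@le_trans _ _ (k%:R * (B * (B / n%:R)))).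
  rewrite ler_wpM2l ?ler0n// ler_pM// mulr_ge0 ?divr_ge0 ?ler0n//; lra.
rewrite !mulrA ler_pdivrMr// -ler_pdivrMl//.
by near: n; exact: nbhs_infty_ger.
Unshelve. all: by end_near. Qed.

Lemma sum_from0 (F : nat -> R) N : F 0%N = 0 ->
  \sum_(1 <= n < N) F n = \sum_(0 <= n < N) F n.
Proof.
move=> F0; case: N => [|N]; first by rewrite !big_geq.
by rewrite [RHS]big_ltn// F0 add0r.
Qed.

Lemma lead_sum_cvg B J : (forall n, `|a n| <= B) ->
  \sum_(1 <= n < N) a n * cos_coeff n @[N --> \oo] --> J ->
  \sum_(1 <= n < N) lead_term n @[N --> \oo] --> 2 * pi ^+ 2 * J.
Proof.
move=> aB HJ.
have E N : \sum_(1 <= n < N) lead_term n =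
    2 * pi ^+ 2 * (\sum_(1 <= n < N) a n * cos_coeff n) +
    pi ^+ 2 * \sum_(0 <= n < N) (defectl n - defectr n).
  rewrite -[X in _ + _ * X]sum_from0; last by rewrite defectr0 subr0 /defectl a0 !(mul0r,mulr0).
  rewrite !mulr_sumr -big_split/= big_nat_cond [RHS]big_nat_cond.
  by apply: eq_bigr => n /andP[/andP[n1 _] _]; exact: lead_termE.
under eq_fun do rewrite E.
have -> : 2 * pi ^+ 2 * J = 2 * pi ^+ 2 * J + pi ^+ 2 * 0 by rewrite mulr0 addr0.
apply: cvgD; apply: cvgM; [exact: cvg_cst|exact: HJ|exact: cvg_cst|].
have H : \sum_(0 <= j < k) defectr (M + j)%N @[M --> \oo] --> \sum_(0 <= j < k) (0 : R).
  apply: cvg_big => [|j _]; first exact: add_continuous.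
  by have := defectr_cvg0 aB; rewrite -(cvg_shiftn j).
rewrite -(cvg_shiftn k); under eq_fun do rewrite sum_defect.
rewrite big1_eq in H; have := cvgN H; rewrite oppr0; exact.
Qed.

Section weighted.
Context (nu B : R) (nu0 : 0 <= nu).
Context (aB : forall N, \sum_(1 <= j < N) lam j `^ nu * a j ^+ 2 <= B).

Let s n : R := lam n `^ nu * a n ^+ 2.

Let s_ge0 n : 0 <= s n. Proof. by rewrite mulr_ge0 ?powR_ge0 ?sqr_ge0. Qed.

Let s0 : s 0%N = 0. Proof. by rewrite /s a0 expr0n mulr0. Qed.

Let sB N : \sum_(0 <= j < N) s j <= B.
Proof. by rewrite -sum_from0. Qed.

Lemma sum_shift_up N : \sum_(0 <= n < N) s (n + k) <= B.
Proof.
have -> : \sum_(0 <= n < N) s (n + k) = \sum_(k <= j < N + k) s j.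
  by rewrite -{2}[k]add0n big_addn addnK.
apply: le_trans (sB (N + k)).
by rewrite [leRHS](big_cat_nat (n := k)) ?leq_addl//= lerDr sumr_ge0.
Qed.

(** Each value j is the distance of k to at most two indices n. *)
Lemma sum_dist N : \sum_(0 <= n < N) s `|n - k|%N <= B + B.
Proof.
have E (n : nat) : s `|n - k|%N <= s (n - k)%N + s (k - n)%N.
  have [nk|kn] := leqP n k.
    by rewrite (_ : `|n - k|%N = (k - n)%N) ?lerDr//; lia.
  by rewrite (_ : `|n - k|%N = (n - k)%N) ?lerDl//; lia.
apply: (le_trans (ler_sum _ (fun n _ => E n))); rewrite big_split/= lerD//.
  have -> : \sum_(0 <= n < N) s (n - k)%N = \sum_(0 <= j < N - k) s j.
    elim: N => [|N IH]; first by rewrite !big_geq.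
    rewrite big_nat_recr//= IH; have [Nk|kN] := ltnP N k.
      have -> : (N.+1 - k = 0)%N by lia.
      have -> : (N - k = 0)%N by lia.
      by rewrite !big_geq// s0 addr0.
    by rewrite subSn// big_nat_recr.
  exact: sB.
apply: le_trans (sB k.+1).
have rev k' N' : \sum_(0 <= n < N') s (k' - n)%N <= \sum_(0 <= j < k'.+1) s j.
  elim: k' N' => [|k' IH] [|N'].
  - by rewrite big_geq// sumr_ge0.
  - by rewrite big_nat1 s0 big1// => n _; rewrite sub0n.
  - by rewrite big_geq// sumr_ge0.
  - rewrite big_ltn// subn0 [leRHS]big_nat_recr//= [leRHS]addrC lerD2l.
    by rewrite big_add1; exact: IH.
exact: rev.
Qed.

Definition lam2_cst : R := 1 + k%:R + k%:R ^+ 2.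

Lemma lam2_cst_ge0 : 0 <= lam2_cst.
Proof. by rewrite /lam2_cst !addr_ge0 ?ler0n ?exprn_ge0. Qed.

(** A factor |l| / (n m) is bounded; the remaining |l|^nu splits as a power of n
    times a power of m, and 2 u v <= u^2 + v^2 separates the two indices. *)
Lemma pair_bound n m (l : R) : (0 < n)%N -> (0 < m)%N ->
  `|l| <= lam2_cst * ((n%:R * pi) * (m%:R * pi)) ->
  `|a n / n%:R * (a m / m%:R) * l| * `|l| `^ nu <=
    lam2_cst * pi ^+ 2 * lam2_cst `^ nu * (s n + s m).
Proof.
move=> n0 m0 ll.
have np : 0 < n%:R :> R by rewrite ltr0n.
have mp : 0 < m%:R :> R by rewrite ltr0n.
have pp := pi_gt0 R.
have kp := lam2_cst_ge0.
have npi : 0 <= n%:R * pi :> R by rewrite mulr_ge0 ?ltW.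
have mpi : 0 <= m%:R * pi :> R by rewrite mulr_ge0 ?ltW.
have h1 : `|a n / n%:R * (a m / m%:R) * l| <= lam2_cst * pi ^+ 2 * (`|a n| * `|a m|).
  rewrite !normrM !normfV !normr_nat.
  apply: (@le_trans _ _ (`|a n| / n%:R * (`|a m| / m%:R) * (lam2_cst * ((n%:R * pi) * (m%:R * pi))))).
    by rewrite ler_wpM2l// !mulr_ge0 ?invr_ge0 ?ltW.
  rewrite le_eqVlt; apply/orP; left; apply/eqP; field.
  by rewrite !gt_eqF.
have h2 : `|l| `^ nu <= lam2_cst `^ nu * ((n%:R * pi) `^ nu * (m%:R * pi) `^ nu).
  have xy0 := mulr_ge0 npi mpi.
  rewrite -(powRM _ npi mpi) -(powRM _ kp xy0).
  by apply: ge0_ler_powR => //; rewrite nnegrE// mulr_ge0.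
have sE j : s j = ((j%:R * pi) `^ nu * `|a j|) ^+ 2.
  have jpi : 0 <= j%:R * pi :> R by rewrite mulr_ge0 ?ler0n ?ltW.
  rewrite exprMn real_normK ?num_real// /s /lam; congr (_ * _).
  by rewrite -(powR_mulrn 2 jpi) -(powR_mulrn 2 (powR_ge0 _ _)) powRAC.
apply: (@le_trans _ _ (lam2_cst * pi ^+ 2 * lam2_cst `^ nu *
    (((n%:R * pi) `^ nu * `|a n|) * ((m%:R * pi) `^ nu * `|a m|)))).
  apply: (@le_trans _ _ (lam2_cst * pi ^+ 2 * (`|a n| * `|a m|) *
      (lam2_cst `^ nu * ((n%:R * pi) `^ nu * (m%:R * pi) `^ nu)))).
    by apply: ler_pM => //; exact: powR_ge0.
  by lra.
rewrite !sE; apply: ler_wpM2l.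
  exact: mulr_ge0 (mulr_ge0 kp (sqr_ge0 _)) (powR_ge0 _ _).
set u := _ * `|a n|; set v := _ * `|a m|.
have u0 : 0 <= u by rewrite mulr_ge0 ?powR_ge0.
have v0 : 0 <= v by rewrite mulr_ge0 ?powR_ge0.
by have := sqr_ge0 (u - v); nra.
Qed.

(** When |n - k| > 0 it is at least 1, so n <= |n - k| + k is at most
    (1 + k) |n - k|: the possible smallness of n - k costs only a factor
    depending on k. *)
Lemma lam2_le n m : (0 < n)%N -> (0 < m)%N -> (m = n + k)%N \/ (m = `|n - k|)%N ->
  `|@lam2 R n k| <= lam2_cst * ((n%:R * pi) * (m%:R * pi)).
Proof.
move=> n0 m0 mE; have npos : 1 <= n%:R :> R by rewrite ler1n.
have mpos : 1 <= m%:R :> R by rewrite ler1n.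
have kpos : 1 <= k%:R :> R by rewrite ler1n.
have nm : n%:R <= m%:R + k%:R :> R by rewrite -natrD ler_nat; lia.
have -> : @lam2 R n k = pi ^+ 2 * (n%:R ^+ 2 - k%:R ^+ 2 / 2) by rewrite /lam2 /lam; field.
rewrite normrM (ger0_norm (sqr_ge0 _)).
have -> : lam2_cst * ((n%:R * pi) * (m%:R * pi)) = pi ^+ 2 * (lam2_cst * (n%:R * m%:R)) by ring.
rewrite ler_wpM2l ?sqr_ge0// /lam2_cst.
move: n%:R m%:R k%:R npos mpos kpos nm => x y z x1 y1 z1 xy.
have xy1 : 1 <= x * y by nra.
have xzy : x <= (1 + z) * y by nra.
have xx : x * x <= x * ((1 + z) * y) by rewrite ler_wpM2l//; lra.
have zz : z ^+ 2 <= z ^+ 2 * (x * y) by rewrite ler_peMr ?sqr_ge0.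
have zx : 0 <= z * (x * y) by rewrite !mulr_ge0//; lra.
have x2 := sqr_ge0 x; have z2 := sqr_ge0 z.
by rewrite ler_norml; apply/andP; split; lra.
Qed.

(** One estimate serves both expansions: nu = 0 gives the summability behind the
    o, and nu > 0 gives the rate under the H^nu hypothesis. *)
Lemma lead_weighted_sum N :
  \sum_(1 <= n < N) `|lead_term n| * `|@lam2 R n k| `^ nu <=
  lam2_cst * pi ^+ 2 * lam2_cst `^ nu * (B *+ 5).
Proof.
set C := lam2_cst * pi ^+ 2 * lam2_cst `^ nu.
have C0 : 0 <= C := mulr_ge0 (mulr_ge0 lam2_cst_ge0 (sqr_ge0 _)) (powR_ge0 _ _).
apply: (@le_trans _ _ (\sum_(1 <= n < N) C * (s n + s n + s (n + k)%N + s `|n - k|%N))).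
  rewrite big_nat_cond [leRHS]big_nat_cond; apply: ler_sum => n /andP[/andP[n0 _] _].
  have nk0 : (0 < n + k)%N by rewrite addn_gt0 n0.
  have h1 := pair_bound n0 nk0 (lam2_le n0 nk0 (or_introl erefl)).
  rewrite /lead_term [a n / _ * (_ + _)]mulrDr [(_ + _) * lam2 n k]mulrDl.
  have h2 : `|a n / n%:R * (a `|n - k|%N / `|n - k|%N%:R * (n != k)%:R) * lam2 n k| *
      `|lam2 n k| `^ nu <= C * (s n + s `|n - k|%N).
    have [->|nk] := eqVneq n k.
      by rewrite !mulr0 mul0r normr0 mul0r mulr_ge0 ?addr_ge0.
    have d0 : (0 < `|n - k|)%N by lia.
    by rewrite mulr1; exact: pair_bound (lam2_le n0 d0 (or_intror erefl)).
  have h3 : C * (s n + s (n + k)%N) + C * (s n + s `|n - k|%N) <=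
      C * (s n + s n + s (n + k)%N + s `|n - k|%N).
    by lra.
  apply: le_trans h3; apply: le_trans (lerD h1 h2).
  by rewrite -[leRHS]mulrDl ler_wpM2r ?powR_ge0// ler_normD.
rewrite -mulr_sumr ler_wpM2l// !big_split/=.
apply: (@le_trans _ _ (B + B + B + (B + B))); last by lra.
have le0 (F : nat -> R) : (forall n, 0 <= F n) -> \sum_(1 <= n < N) F n <= \sum_(0 <= n < N) F n.
  move=> F0; case: N => [|N']; first by rewrite !big_geq.
  by rewrite [leRHS]big_ltn// lerDr.
rewrite !lerD//.
- by apply: le_trans (sum_shift_up N); exact: (le0 (fun n => s (n + k)%N)).
- by apply: le_trans (sum_dist N); exact: (le0 (fun n => s `|n - k|%N)).
Qed.
End weighted.

End series.

(** * Expansion of K *)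

Section main.
Context {R : realType}.
Context (mu : R -> R) (k : nat) (hmu : in_L2 mu) (hk : (1 <= k)%N).

Let a n := inner mu (phi n).
Let lead := lead_term a k.

Lemma coeff0 : a 0 = 0.
Proof.
rewrite /a innerC (@eq_inner _ _ (fun=> 0)); last by move=> x _; rewrite phi0.
by rewrite /inner; under eq_Rintegral do rewrite mul0r; rewrite Rintegral_D_cst.
Qed.

Lemma bessel N : \sum_(1 <= n < N) a n ^+ 2 <= inner mu mu.
Proof.
have P := parseval hmu hmu.
rewrite -(cvg_lim _ P)//.
have -> : \sum_(1 <= n < N) a n ^+ 2 = \sum_(1 <= n < N) a n * a n.
  by apply: eq_bigr => n _; rewrite expr2.
apply: (nondecreasing_cvgn_le (u_ := fun N => \sum_(1 <= n < N) a n * a n)); last first.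
  by apply/cvg_ex; eexists; exact: P.
apply/nondecreasing_seqP => n; case: n => [|n]; first by rewrite !big_geq.
by rewrite [leRHS]big_nat_recr//= lerDl -expr2 sqr_ge0.
Qed.

Lemma coeff_bounded n : `|a n| <= inner mu mu + 1.
Proof.
have [->|n0] := posnP n; first by rewrite coeff0 normr0 addr_ge0 ?inner_ge0.
have := bessel n.+1; rewrite big_nat_recr//= => h.
have s0 : 0 <= \sum_(1 <= i < n) a i ^+ 2 by apply: sumr_ge0 => i _; exact: sqr_ge0.
have := real_normK (num_real (a n)); have := normr_ge0 (a n); have := inner_ge0 mu.
nra.
Qed.

Lemma lead_cvg : \sum_(1 <= n < N) lead n @[N --> \oo] -->
  pi * Num.sqrt 2 * inner (fun x => mu x ^+ 2) (derive1 (phi k)) / k%:R.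
Proof.
have gL2 := in_L2_mul_cos k hmu.
pose J := inner mu (fun x => mu x * cos (k%:R * pi * x)).
have -> : pi * Num.sqrt 2 * inner (fun x => mu x ^+ 2) (derive1 (phi k)) / k%:R =
    2 * pi ^+ 2 * J.
  have kn : k%:R != 0 :> R by rewrite pnatr_eq0 -lt0n.
  have -> : inner (fun x => mu x ^+ 2) (derive1 (phi k)) = Num.sqrt 2 * (k%:R * pi) * J.
    rewrite /J /inner -RintegralZl//; last exact: L2_mul_integrable.
    apply: eq_Rintegral => x _.
    have dsin := is_derive_sin_scale (k%:R * pi) x.
    have -> : derive1 (@phi R k) x = Num.sqrt 2 * (k%:R * pi * cos (k%:R * pi * x)).
      rewrite derive1E; have := is_deriveZ (Num.sqrt 2) dsin.
      by case=> _ ->.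
    ring.
  rewrite -[X in _ = X * _ * _](@sqr_sqrtr _ 2)//; by field.
apply: (@lead_sum_cvg R a k coeff0 hk (inner mu mu + 1) J coeff_bounded).
have := parseval hmu gL2.
rewrite (_ : (fun N => _) = (fun N => \sum_(1 <= n < N) a n * cos_coeff a k n)) //.
apply/funext => N; apply: eq_bigr => n _; congr (_ * _).
have -> : inner (fun x => mu x * cos (k%:R * pi * x)) (phi n) =
   inner mu (fun x => phi n x * cos (k%:R * pi * x)).
  by apply: eq_Rintegral => x _; ring.
have -> : inner mu (fun x => phi n x * cos (k%:R * pi * x)) =
   inner (fun x => 2^-1 * phi (n + k)%N x + (2^-1 * (-1) ^+ (n < k)%N) * phi `|n - k|%N x) mu.
  by apply: eq_Rintegral => x _; rewrite phi_mul_cos; ring.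
have pL2 := @in_L2_phi R.
rewrite (innerDl (in_L2Z _ (pL2 _)) (in_L2Z _ (pL2 _)) hmu).
rewrite (innerZl _ (pL2 (n + k)%N) hmu) (innerZl _ (pL2 `|n - k|%N) hmu).
by rewrite /cos_coeff /a !(innerC (phi _) mu); ring.
Qed.

Lemma KtermE (om : R) n : 0 < om ->
  om ^+ 2 * Kterm mu k om n - lead n =
  - (lead n * (lam2 n k ^+ 2 / (lam2 n k ^+ 2 + om ^+ 2))).
Proof.
move=> om0; have d0 : lam2 n k ^+ 2 + om ^+ 2 != 0.
  by rewrite gt_eqF// ltr_wpDl ?sqr_ge0 ?exprn_gt0.
rewrite /lead /lead_term /Kterm -/(a _).
by move: (a n / _) (a (n + k)%N / _ + _) => x y; field.
Qed.

(** The remainder identity is summed up to N and N is sent to infinity; the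
    absolute summability of the series of c_n l_n ensures that the series
    defining K converges. *)
Lemma Kfun_remainder (om C E : R) : 0 < om ->
  (forall N, \sum_(1 <= n < N) `|lead n| <= C) ->
  (forall N, \sum_(1 <= n < N) `|lead n| * (lam2 n k ^+ 2 / (lam2 n k ^+ 2 + om ^+ 2)) <= E) ->
  `|Kfun mu k om - pi * Num.sqrt 2
     * inner (fun x => mu x ^+ 2) (derive1 (phi k)) / (k%:R * om ^+ 2)| <=
  E / om ^+ 2.
Proof.
move=> om0 hC hE.
have om20 : 0 < om ^+ 2 by rewrite exprn_gt0.
have frac n : 0 <= lam2 n k ^+ 2 / (lam2 n k ^+ 2 + om ^+ 2) <= 1.
  have h : 0 < lam2 n k ^+ 2 + om ^+ 2 by rewrite ltr_wpDl ?sqr_ge0.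
  rewrite divr_ge0 ?sqr_ge0 ?(ltW h)//= ler_pdivrMr// mul1r lerDl ltW//.
have lead_bd n : `|Kterm mu k om n| <= `|lead n| / om ^+ 2.
  have e : om ^+ 2 * Kterm mu k om n =
     lead n * (1 - lam2 n k ^+ 2 / (lam2 n k ^+ 2 + om ^+ 2)).
    by have := KtermE n om0; rewrite mulrBr mulr1 => <-; ring.
  rewrite ler_pdivlMr// mulrC -[X in X * _](gtr0_norm om20) -normrM e normrM.
  by rewrite ler_piMr// ger0_norm; have /andP[] := frac n; lra.
have K0 : Kterm mu k om 0 = 0 by rewrite /Kterm invr0 mulr0 !mul0r.
have lead0 : lead 0 = 0 by rewrite /lead /lead_term invr0 mulr0 !mul0r.
have cK : cvgn (fun N => \sum_(1 <= n < N) Kterm mu k om n).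
  rewrite (_ : (fun N => _) = series (Kterm mu k om)); last first.
    by apply/funext => N; rewrite sum_from0.
  apply: normed_cvg; apply: nondecreasing_is_cvgn.
    by apply: nondecreasing_series => n _ _; exact: normr_ge0.
  exists (C / om ^+ 2) => _ [N _ <-].
  apply: (@le_trans _ _ ((\sum_(0 <= n < N) `|lead n|) / om ^+ 2)).
    by rewrite mulr_suml; apply: ler_sum => n _; exact: lead_bd.
  rewrite ler_pM2r ?invr_gt0// -(sum_from0 (F := fun n => `|lead n|))//.
  by rewrite lead0 normr0.
set L := pi * Num.sqrt 2 * inner (fun x => mu x ^+ 2) (derive1 (phi k)).
have diff : \sum_(1 <= n < N) Kterm mu k om n - (\sum_(1 <= n < N) lead n) / om ^+ 2 @[N --> \oo] -->
    Kfun mu k om - L / k%:R / om ^+ 2.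
  by apply: cvgB; [exact: cK|apply: cvgM; [exact: lead_cvg|exact: cvg_cst]].
have -> : L / (k%:R * om ^+ 2) = L / k%:R / om ^+ 2 by rewrite invfM mulrA.
apply: (cvgr_to_le (cvg_norm diff)); apply: nearW => N.
have -> : \sum_(1 <= n < N) Kterm mu k om n - (\sum_(1 <= n < N) lead n) / om ^+ 2 =
    - (\sum_(1 <= n < N) lead n * (lam2 n k ^+ 2 / (lam2 n k ^+ 2 + om ^+ 2))) / om ^+ 2.
  rewrite mulr_suml -sumrB -sumrN mulr_suml; apply: eq_bigr => n _.
  by rewrite -KtermE//; field; rewrite gt_eqF.
rewrite normrM normrN (@ger0_norm _ (om ^+ 2)^-1) ?invr_ge0 ?(ltW om20)//.
rewrite ler_pM2r ?invr_gt0//.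
apply: le_trans (ler_norm_sum _ _ _) _; apply: le_trans (hE N).
apply: ler_sum => n _; have /andP[f0 _] := frac n.
by rewrite normrM (ger0_norm f0).
Qed.

Lemma lead_summable : exists C, forall N, \sum_(1 <= n < N) `|lead n| <= C.
Proof.
have hB N : \sum_(1 <= j < N) lam j `^ 0 * a j ^+ 2 <= inner mu mu.
  by under eq_bigr do rewrite powRr0 mul1r; exact: bessel.
exists (lam2_cst k * pi ^+ 2 * lam2_cst k `^ 0 * (inner mu mu *+ 5)) => N.
have := lead_weighted_sum coeff0 hk (lexx 0) hB N.
by under eq_bigr do rewrite powRr0 mulr1.
Qed.

(** For |l| <= w the quotient is at most (|l| / w)^2, and the exponent may be
    lowered from 2 to nu since the base is at most 1. For |l| >= w the right-hand
    side is at least 1. *)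
Lemma frac_le_powR (l om nu : R) : 0 < om -> 0 <= nu -> nu <= 2 ->
  l ^+ 2 / (l ^+ 2 + om ^+ 2) <= `|l| `^ nu / om `^ nu.
Proof.
move=> om0 nu0 nu2; have om20 : 0 < om ^+ 2 by rewrite exprn_gt0.
have h : 0 < l ^+ 2 + om ^+ 2 by rewrite ltr_wpDl ?sqr_ge0.
have [->|l0] := eqVneq l 0.
  by rewrite expr0n mul0r divr_ge0 ?powR_ge0.
have ln : 0 < `|l| by rewrite normr_gt0.
have pw : 0 < om `^ nu by rewrite powR_gt0.
have [lo|ol] := leP `|l| om.
  apply: (@le_trans _ _ (l ^+ 2 / om ^+ 2)).
    by rewrite ler_pM2l ?exprn_even_gt0// lef_pV2 ?posrE// lerDr sqr_ge0.
  have two : l ^+ 2 = `|l| `^ nu * `|l| `^ (2 - nu).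
    rewrite -powRD; last by rewrite (gt_eqF ln) implybT.
    by rewrite subrKC (@powR_mulrn _ _ 2)// real_normK ?num_real.
  have two' : om ^+ 2 = om `^ nu * om `^ (2 - nu).
    rewrite -powRD; last by rewrite (gt_eqF om0) implybT.
    by rewrite subrKC (@powR_mulrn _ _ 2)// ltW.
  rewrite two two' invfM mulrACA ler_piMr ?divr_ge0 ?powR_ge0//.
  rewrite ler_pdivrMr ?powR_gt0// mul1r.
  by apply: ge0_ler_powR; rewrite ?nnegrE ?subr_ge0// ltW.
apply: (@le_trans _ _ 1).
  by rewrite ler_pdivrMr// mul1r lerDl ltW.
rewrite ler_pdivlMr// mul1r; apply: ge0_ler_powR; rewrite ?nnegrE//; exact: ltW.
Qed.

End main.

Theorem proposition3p1 (R : realType) (mu : R -> R) (k : nat)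
    (hmu : in_L2 mu) (hk : (1 <= k)%N) :
  let main := fun omega : R =>
    pi * Num.sqrt 2 * inner (fun x => mu x ^+ 2) (derive1 (phi k))
    / (k%:R * omega ^+ 2) in
  (Kfun mu k = main +o_ (pinfty_nbhs R) (fun omega => 1 / omega ^+ 2))
  /\
  (forall nu : R, 0 < nu -> nu <= 2 -> in_H nu mu ->
     Kfun mu k =
       main +O_ (pinfty_nbhs R) (fun omega => 1 / omega `^ (2 + nu))).
Proof.
move=> main; have [C hC] := lead_summable hmu hk.
have a0 := coeff0 mu.
pose lead n := lead_term (fun n => inner mu (phi n)) k n.
split.
  apply/eqaddoP => e e0.
  have e20 : 0 < e / 2 by rewrite divr_gt0.
  have [M M1 hM] : exists2 M, (1 <= M)%N & forall N, \sum_(M <= n < N) `|lead n| <= e / 2.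
    pose T N := \sum_(1 <= n < N) `|lead n|.
    have ndT : nondecreasing_seq T.
      apply/nondecreasing_seqP => -[|n]; first by rewrite /T !big_geq.
      by rewrite /T [leRHS]big_nat_recr//= lerDl.
    have cT : cvgn T by apply: nondecreasing_is_cvgn => //; exists C => _ [n _ <-]; exact: hC.
    have /cvgrPdist_le/(_ _ e20)[M _ hM] := cT.
    exists M.+1 => // N; have [NM|MN] := leqP N M.+1; first by rewrite big_geq// ltW.
    have E : T N = T M.+1 + \sum_(M.+1 <= n < N) `|lead n|.
      by rewrite /T -big_cat_nat//= ltnW.
    have := hM M.+1 (leqnSn M); rewrite ler_norml => /andP[_].
    by have := nondecreasing_cvgn_le ndT cT N; rewrite E; lra.
  (* The terms from M on contribute at most e / 2 for every omega; the finitely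
     many others contribute at most S / omega^2. *)
  pose S := \sum_(1 <= n < M) `|lead n| * lam2 n k ^+ 2.
  have S0 : 0 <= S by apply: sumr_ge0 => n _; rewrite mulr_ge0 ?sqr_ge0.
  near=> om.
  have om0 : 0 < om by near: om; exact: nbhs_pinfty_gt.
  have om1 : 1 <= om by near: om; exact: nbhs_pinfty_ge.
  have omS : S / (e / 2) <= om.
    by near: om; apply: nbhs_pinfty_ge; exact: num_real.
  have om20 : 0 < om ^+ 2 by rewrite exprn_gt0.
  have -> : `|1 / om ^+ 2| = (om ^+ 2)^-1 by rewrite div1r ger0_norm// invr_ge0 ltW.
  apply: (Kfun_remainder hmu hk om0 hC) => N.
  pose r n := @lam2 R n k ^+ 2 / (lam2 n k ^+ 2 + om ^+ 2).
  have den n : 0 < @lam2 R n k ^+ 2 + om ^+ 2 by rewrite ltr_wpDl ?sqr_ge0.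
  have r0 n : 0 <= r n by rewrite divr_ge0 ?sqr_ge0// ltW.
  have r1 n : r n <= 1 by rewrite ler_pdivrMr// mul1r lerDl ltW.
  have r2 n : r n <= lam2 n k ^+ 2 / om ^+ 2.
    by rewrite ler_wpM2l ?sqr_ge0// lef_pV2 ?posrE// lerDr sqr_ge0.
  have term0 n : 0 <= `|lead n| * r n by rewrite mulr_ge0.
  apply: (@le_trans _ _ (\sum_(1 <= n < maxn M N) `|lead n| * r n)).
    case: N => [|N]; first by rewrite big_geq// sumr_ge0.
    by rewrite [leRHS](@big_cat_nat _ _ _ N.+1)//= ?leq_maxr// lerDl sumr_ge0.
  rewrite (@big_cat_nat _ _ _ M)//= ?leq_maxl// [leRHS]splitr lerD//.
    apply: (@le_trans _ _ (S / om ^+ 2)).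
      by rewrite mulr_suml; apply: ler_sum => n _; rewrite -mulrA ler_wpM2l.
    rewrite ler_pdivrMr// mulrC -ler_pdivrMr//; apply: le_trans omS _.
    by rewrite expr2 ler_peMr// ltW.
  apply: le_trans (hM (maxn M N)); apply: ler_sum => n _.
  by rewrite ler_piMr.
move=> nu nu0 nu2 [_ hH].
apply/eqaddOP; apply/bigO_exP.
pose s n : R := lam n `^ nu * inner mu (phi n) ^+ 2.
have s0 n : 0 <= s n by rewrite mulr_ge0 ?powR_ge0 ?sqr_ge0.
have [B hB] : exists B, forall N, \sum_(1 <= j < N) s j <= B.
  exists (fine (\sum_(1 <= j <oo) (s j)%:E)%E) => N.
  rewrite -lee_fin fineK; last first.
    by rewrite ge0_fin_numE//; apply: nneseries_ge0 => n _ _; rewrite lee_fin.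
  rewrite -sumEFin; apply: nneseries_lim_ge => n _ _; by rewrite lee_fin.
pose C' := lam2_cst k * pi ^+ 2 * lam2_cst k `^ nu * (B *+ 5).
have hC' N : \sum_(1 <= n < N) `|lead n| * `|lam2 n k| `^ nu <= C'.
  exact: (lead_weighted_sum a0 hk (ltW nu0) hB).
have C'0 : 0 <= C' by have := hC' 0%N; rewrite big_geq.
exists (C' + 1); first by rewrite ltr_wpDl.
near=> om.
have om0 : 0 < om by near: om; exact: nbhs_pinfty_gt.
have pw : 0 < om `^ nu by rewrite powR_gt0.
have -> : `|1 / om `^ (2 + nu)| = (om `^ nu)^-1 / om ^+ 2.
  rewrite powRD; last by rewrite (gt_eqF om0) implybT.
  rewrite (@powR_mulrn _ _ 2) ?(ltW om0)// div1r invfM mulrC.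
  by rewrite ger0_norm// divr_ge0 ?invr_ge0 ?powR_ge0 ?sqr_ge0.
apply: (@le_trans _ _ (C' / om `^ nu / om ^+ 2)).
  apply: (Kfun_remainder hmu hk om0 hC) => N.
  apply: (@le_trans _ _ (\sum_(1 <= n < N) `|lead n| * `|lam2 n k| `^ nu / om `^ nu)).
    apply: ler_sum => n _; rewrite -mulrA ler_wpM2l//.
    exact: frac_le_powR (ltW nu0) nu2.
  by rewrite -mulr_suml ler_pM2r ?invr_gt0.
rewrite mulrA ler_wpM2r ?invr_ge0 ?sqr_ge0// ler_wpM2r ?invr_ge0 ?powR_ge0//.
by rewrite lerDl.
Unshelve. all: by end_near.
Qed.
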